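(* Let $(V,\leq)$ be a countably infinite partially ordered set and let $(V,E)$ be a directed acyclic graph whose transitive closure induces $\leq$ (i.e. for $x\neq y$, $x\leq y$ if and only if there is a directed path in $(V,E)$ from $x$ to $y$). Let $\mu_1,\mu_2$ be probability measures on $V$. The following statements are equivalent: (1) $\mu_1\preceq\mu_2$; (2) there exists a coupling between $\mu_1$ and $\mu_2$ which is compatible with $\leq$; (3) there exists a finitely decomposable flow $Q$ on $(V,E)$ such that $\operatorname{div}Q=\mu_1-\mu_2$.
   Context: Digraphs have no loops. A coupling between probability measures $\mu_1,\mu_2$ on $V$ is a probability measure $\rho$ on $V\times V$ with $\sum_{y}\rho(x,y)=\mu_1(x)$ and $\sum_x\rho(x,y)=\mu_2(y)$ for all $x,y$; it is compatible with $\leq$ if $\rho(\{(x,y):x\leq y\})=1$. $\mu_1\preceq\mu_2$ means $\mathbb E_{\mu_1}(f)\leq\mathbb E_{\mu_2}(f)$ for every bounded increasing $f:V\to\mathbb R$. A flow on $(V,E)$ is a map $Q:E\to[0,+\infty)$; its divergence is $\operatorname{div}Q(x)=\sum_{y:(x,y)\in E}Q(x,y)-\sum_{y:(y,x)\in E}Q(y,x)$, defined when both series converge for every $x$. For a directed path $\gamma=(x_0,\dots,x_n)$ let $Q_\gamma(x,y)=1$ if $(x,y)=(x_i,x_{i+1})$ for some $i$ and $0$ otherwise. A path is self-avoiding if its vertices are pairwise distinct. A flow $Q$ is finitely decomposable if there exist a countable family $\{\gamma_n\}$ of finite self-avoiding directed paths in $(V,E)$ and weights $q_n\ge 0$ with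 $\sum_n q_n<+\infty$ such that $Q=\sum_n q_nQ_{\gamma_n}$ pointwise on $E$. *)

(* Defs.v *)
From HB Require Import structures.
From mathcomp Require Import all_boot all_order all_algebra.
From mathcomp Require Import all_classical all_reals.
From mathcomp Require Import ereal esum.
Set Implicit Arguments. Unset Strict Implicit. Unset Printing Implicit Defensive.
Import Order.TTheory GRing.Theory Num.Theory.
Local Open Scope ring_scope.
Local Open Scope classical_set_scope.

Section Defs.
Variables (R : realType) (V : countType).

Definition prob_measure (mu : V -> R) : Prop :=
  (forall x, 0 <= mu x) /\ (\esum_(x in [set: V]) (mu x)%:E = 1%E).

(* expectation of f under mu: sum of f(x) mu(x), split into positive and
   negative parts (both finite when f is bounded and mu is a probability) *)
Definition expect (mu : V -> R) (f : V -> R) : \bar R :=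
  (\esum_(x in [set: V]) (Num.max (f x) 0 * mu x)%:E
   - \esum_(x in [set: V]) (Num.max (- f x) 0 * mu x)%:E)%E.

Definition bounded_fun (f : V -> R) : Prop := exists M : R, forall x, `|f x| <= M.

Definition increasing_fun (le : V -> V -> Prop) (f : V -> R) : Prop :=
  forall x y, le x y -> f x <= f y.

Definition stoch_dom (le : V -> V -> Prop) (mu1 mu2 : V -> R) : Prop :=
  forall f, bounded_fun f -> increasing_fun le f ->
    (expect mu1 f <= expect mu2 f)%E.

Definition coupling (mu1 mu2 : V -> R) (rho : V * V -> R) : Prop :=
  (forall p, 0 <= rho p) /\
  (\esum_(p in [set: V * V]) (rho p)%:E = 1%E) /\
  (forall x, \esum_(y in [set: V]) (rho (x, y))%:E = (mu1 x)%:E) /\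
  (forall y, \esum_(x in [set: V]) (rho (x, y))%:E = (mu2 y)%:E).

Definition compatible (le : V -> V -> Prop) (rho : V * V -> R) : Prop :=
  \esum_(p in [set p : V * V | le p.1 p.2]) (rho p)%:E = 1%E.

Fixpoint is_dpath (E : V -> V -> Prop) (p : seq V) : Prop :=
  match p with
  | x :: ((y :: _) as q) => E x y /\ is_dpath E q
  | _ => True
  end.

Definition directed_path (E : V -> V -> Prop) (p : seq V) : Prop :=
  (0 < size p)%N /\ is_dpath E p.

Definition reach (E : V -> V -> Prop) (x y : V) : Prop :=
  exists p : seq V, p <> [::] /\ is_dpath E (x :: p) /\ last x p = y.

Definition is_DAG (E : V -> V -> Prop) : Prop :=
  (forall x, ~ E x x) /\ (forall x, ~ reach E x x).

Definition partial_order (le : V -> V -> Prop) : Prop :=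
  (forall x, le x x) /\
  (forall x y, le x y -> le y x -> x = y) /\
  (forall x y z, le x y -> le y z -> le x z).

Fixpoint edge_in (x y : V) (p : seq V) : bool :=
  match p with
  | a :: ((b :: _) as q) => ((a == x) && (b == y)) || edge_in x y q
  | _ => false
  end.

Definition Qpath (p : seq V) (x y : V) : R := (edge_in x y p)%:R.

Definition outflow (E : V -> V -> Prop) (Q : V -> V -> R) (x : V) : \bar R :=
  \esum_(y in [set y | E x y]) (Q x y)%:E.
Definition inflow (E : V -> V -> Prop) (Q : V -> V -> R) (x : V) : \bar R :=
  \esum_(y in [set y | E y x]) (Q y x)%:E.

(* Q is a flow on (V,E) (nonnegative on edges; values off E are irrelevant),
   its divergence is defined everywhere (both series converge) and equals d *)
Definition flow (E : V -> V -> Prop) (Q : V -> V -> R) : Prop :=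
  forall x y, E x y -> 0 <= Q x y.

Definition div_eq (E : V -> V -> Prop) (Q : V -> V -> R) (d : V -> R) : Prop :=
  forall x, outflow E Q x \is a fin_num /\ inflow E Q x \is a fin_num /\
    fine (outflow E Q x) - fine (inflow E Q x) = d x.

Definition finitely_decomposable (E : V -> V -> Prop) (Q : V -> V -> R) : Prop :=
  exists (g : nat -> seq V) (q : nat -> R),
    (forall n, directed_path E (g n) /\ uniq (g n)) /\
    (forall n, 0 <= q n) /\
    (\esum_(n in [set: nat]) (q n)%:E < +oo)%E /\
    (forall x y, E x y ->
       (Q x y)%:E = \esum_(n in [set: nat]) (q n * Qpath (g n) x y)%:E).

End Defs.

(* Main.v *)
Require Import Defs.
From HB Require Import structures.
From mathcomp Require Import all_boot all_order all_algebra.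
From mathcomp Require Import all_classical all_reals.
From mathcomp Require Import ereal topology normedtype esum lra.
Import Order.TTheory GRing.Theory Num.Theory numFieldNormedType.Exports.
Local Open Scope ring_scope.
Local Open Scope classical_set_scope.

(** Stochastic domination is equivalent to [mu1 U <= mu2 U] for every up-set
    [U], and this Hall-type condition yields a compatible coupling: among the
    measures supported on [<=] whose marginals are bounded by [mu1] and [mu2]
    there is one of maximal mass, and a mass deficit would produce an up-set
    violating the condition.  A compatible coupling [rho] becomes a flow by
    sending mass [rho (x, y)] along a path from [x] to [y].  Conversely, in a
    decomposed flow the paths start with mass [s] and end with mass [t], where
    [mu1 + t = mu2 + s]; a path starting in an up-set also ends in it, so
    [s U <= t U] and hence [mu1 U <= mu2 U]. *)

(** * Sums over arbitrary index types *)

Section EsumComplements.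
Context {R : realType}.
Local Open Scope ereal_scope.

Lemma esum_pair {T U : choiceType} (a : T * U -> \bar R) :
  (forall p, 0 <= a p) ->
  \esum_(p in [set: T * U]) a p =
  \esum_(x in [set: T]) \esum_(y in [set: U]) a (x, y).
Proof.
move=> a0; rewrite esum_esum//; transitivity (esum ([set: T] `*`` (fun=> [set: U])) a).
  by congr (esum _ _); apply/seteqP; split.
by apply: eq_esum => -[].
Qed.

Lemma esum_exchange {T U : choiceType} (A : set T) (B : set U)
    (a : T -> U -> \bar R) : (forall x y, 0 <= a x y) ->
  \esum_(x in A) \esum_(y in B) a x y = \esum_(y in B) \esum_(x in A) a x y.
Proof.
move=> a0; rewrite !esum_esum//.
rewrite (@reindex_esum _ _ _ (B `*`` (fun=> A)) _ (fun p => (p.2, p.1)))//.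
split => [p [? ?] //|[a1 a2] [b1 b2] _ _ [-> ->]//|[x y] [? ?]].
by exists (y, x).
Qed.

(** Scaling finite partial sums gives one inequality ([half]); the other is the same inequality for
    [c^-1], so [c = 0] is treated apart. *)
Lemma esumZl {T : choiceType} (A : set T) (c : R) (a : T -> \bar R) :
  (0 <= c)%R -> (forall x, 0 <= a x) ->
  \esum_(x in A) (c%:E * a x) = c%:E * \esum_(x in A) a x.
Proof.
rewrite le_eqVlt => /predU1P[<- _|c0 a0].
  by rewrite mul0e esum1// => x _; rewrite mul0e.
have half (d : R) (b : T -> \bar R) : (0 < d)%R -> (forall x, 0 <= b x) ->
    \esum_(x in A) (d%:E * b x) <= d%:E * \esum_(x in A) b x.
  move=> d0 b0; apply: ge_ereal_sup => _ [X [fX XA] <-].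
  rewrite -ge0_mule_fsumr// lee_pmul2l ?lte_fin//.
  by apply: esum_ge; exists X.
apply/eqP; rewrite eq_le half//=.
rewrite -(@lee_pmul2l _ (c^-1)%:E) ?lte_fin ?invr_gt0// muleA -EFinM.
rewrite mulVf ?gt_eqF// mul1e.
apply: le_trans (half c^-1%R _ _ _); rewrite ?invr_gt0//; last first.
  by move=> x; rewrite mule_ge0// lee_fin ltW.
apply: le_esum => x _; by rewrite muleA -EFinM mulVf ?gt_eqF// mul1e.
Qed.

Lemma esum_pred1 {T : choiceType} (A : set T) (x0 : T) (f : T -> \bar R) :
  A x0 -> 0 <= f x0 -> (forall x, A x -> x <> x0 -> f x = 0) ->
  \esum_(x in A) f x = f x0.
Proof.
move=> Ax0 f0 fx; rewrite (esumID [set x0])//; last first.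
  by move=> x Ax; have [->//|/eqP/fx->] := eqVneq x x0.
rewrite [X in _ + X]esum1; last by move=> x [Ax /fx->].
by rewrite adde0 setIidr ?esum_set1// => _ ->.
Qed.

Lemma le_esum_subset {T : choiceType} (A B : set T) (f : T -> \bar R) :
  A `<=` B -> \esum_(x in A) f x <= \esum_(x in B) f x.
Proof.
move=> AB; apply: ge_ereal_sup => _ [X [fX XA] <-].
by apply: esum_ge; exists X => //; split => // x /XA/AB.
Qed.

(** The term at [x0] is split off. Finiteness of the larger sum makes the remainder of the smaller
    one finite, so adding it keeps the inequality strict. *)
Lemma lt_esum {T : choiceType} (A : set T) (f g : T -> \bar R) (x0 : T) :
  (forall x, A x -> 0 <= f x) -> (forall x, A x -> f x <= g x) ->
  A x0 -> f x0 < g x0 -> \esum_(x in A) g x \is a fin_num ->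
  \esum_(x in A) f x < \esum_(x in A) g x.
Proof.
move=> f0 fg Ax0 fgx0.
have g0 x : A x -> 0 <= g x by move=> Ax; apply: le_trans (fg x Ax); exact: f0.
rewrite (esumID [set x0] A g)// (esumID [set x0] A f)// setIidr => [|_ -> //].
rewrite !esum_set1 ?f0 ?g0// fin_numD => /andP[_ gfin].
have le_rest : \esum_(i in A `&` ~` [set x0]) f i <=
    \esum_(i in A `&` ~` [set x0]) g i by apply: le_esum => x [/fg].
apply: lte_leD => //; rewrite ge0_fin_numE; last by apply: esum_ge0 => x [/f0].
by apply: le_lt_trans le_rest _; rewrite ltey_eq gfin.
Qed.

(** Take a finite partial sum within [e] of the supremum; the tail is the difference. *)
Lemma esum_tail {T : choiceType} (a : T -> \bar R) (e : R) :
  (forall x, 0 <= a x) -> \esum_(x in [set: T]) a x \is a fin_num -> (0 < e)%R ->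
  exists2 X : set T, finite_set X & \esum_(x in ~` X) a x <= e%:E.
Proof.
move=> a0 afin e0; have [_ [X [fX _] <-] ltX] := ub_ereal_sup_adherent e0 afin.
exists X => //; move: ltX afin.
rewrite -/(esum [set: T] a) (esumID X)// !setTI esum_fset//.
set s := \sum_(_ \in _) _; set t := esum _ _ => ltX.
rewrite fin_numD => /andP[sfin tfin]; move: ltX.
rewrite -(fineK sfin) -(fineK tfin) -EFinD lte_fin lee_fin; lra.
Qed.

End EsumComplements.

Lemma cvg_fsum {R : realType} {I : choiceType} {T : Type} (F : set_system T)
    (A : set I) (f : I -> T -> R) (l : I -> R) : Filter F -> finite_set A ->
  (forall i, f i @ F --> l i) ->
  (fun t => \sum_(i \in A) f i t) @ F --> \sum_(i \in A) l i.
Proof.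
move=> FF fA fl; rewrite fsbig_finite//.
under eq_fun do rewrite fsbig_finite//.
apply: cvg_big => //; exact: add_continuous.
Qed.

(** * Strassen's theorem for a relation between discrete measures *)

Section Strassen.
Context {R : realType} {V W : choiceType}.
Variables (r : V -> W -> Prop) (mu : V -> R) (nu : W -> R).
Implicit Type rho : V * W -> R.

Definition row_mass rho x : \bar R := \esum_(y in [set: W]) (rho (x, y))%:E.
Definition col_mass rho y : \bar R := \esum_(x in [set: V]) (rho (x, y))%:E.
Definition total_mass rho : \bar R := \esum_(p in [set: V * W]) (rho p)%:E.

(** The marginals are only bounded above because such bounds survive pointwise limits, whereas
    equality could be lost by mass escaping to infinity. *)
Definition subcoupling rho : Prop :=
  [/\ forall p, 0 <= rho p, forall p, ~ r p.1 p.2 -> rho p = 0,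
      forall x, (row_mass rho x <= (mu x)%:E)%E &
      forall y, (col_mass rho y <= (nu y)%:E)%E].

Definition maximal rho : Prop :=
  subcoupling rho /\
  forall rho', subcoupling rho' -> (total_mass rho' <= total_mass rho)%E.

Lemma total_row rho : (forall p, 0 <= rho p) ->
  total_mass rho = \esum_(x in [set: V]) row_mass rho x.
Proof. by move=> rho0; rewrite /total_mass esum_pair. Qed.

Lemma total_col rho : (forall p, 0 <= rho p) ->
  total_mass rho = \esum_(y in [set: W]) col_mass rho y.
Proof.
by move=> rho0; rewrite total_row// esum_exchange// => x y; rewrite lee_fin.
Qed.

Lemma row_ge0 rho x : (forall p, 0 <= rho p) -> (0 <= row_mass rho x)%E.
Proof. by move=> rho0; apply: esum_ge0 => y _; rewrite lee_fin. Qed.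

Lemma col_ge0 rho y : (forall p, 0 <= rho p) -> (0 <= col_mass rho y)%E.
Proof. by move=> rho0; apply: esum_ge0 => x _; rewrite lee_fin. Qed.

Hypothesis mu_fin : \esum_(x in [set: V]) (mu x)%:E \is a fin_num.
Hypothesis nu_fin : \esum_(y in [set: W]) (nu y)%:E \is a fin_num.
Hypothesis mu_ge0 : forall x, 0 <= mu x.
Hypothesis nu_ge0 : forall y, 0 <= nu y.

(** * Tightness and maximal subcouplings *)

Lemma subcoupling_le rho p : subcoupling rho -> rho p <= mu p.1.
Proof.
case: p => x y [rho0 _ rowle _]; rewrite -lee_fin; apply: le_trans (rowle x).
have <- : \esum_(z in [set y]) (rho (x, z))%:E = (rho (x, y))%:E.
  by rewrite esum_set1// lee_fin.
exact: le_esum_subset.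
Qed.

Lemma subcoupling_total rho : subcoupling rho ->
  (total_mass rho <= \esum_(x in [set: V]) (mu x)%:E)%E.
Proof. by case=> rho0 _ rowle _; rewrite total_row//; exact: le_esum. Qed.

(** A pair outside [X * Y] lies in a row outside [X] or in a column outside [Y]. The resulting bound
    on the missing mass depends on [mu] and [nu] alone, hence is uniform in [rho]. *)
Lemma subcoupling_tail rho (X : set V) (Y : set W) : subcoupling rho ->
  finite_set X -> finite_set Y ->
  (total_mass rho <= (\sum_(p \in X `*` Y) rho p)%:E
    + \esum_(x in ~` X) (mu x)%:E + \esum_(y in ~` Y) (nu y)%:E)%E.
Proof.
move=> [rho0 _ rowle colle] fX fY; have fXY := finite_setX fX fY.
have rho0' p : (0 <= (rho p)%:E)%E by rewrite lee_fin.
rewrite /total_mass (esumID (X `*` Y))// !setTI -addeA leeD//.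
  by rewrite esum_fset// fsumEFin.
apply: (@le_trans _ _
    (\esum_(x in ~` X) row_mass rho x + \esum_(y in ~` Y) col_mass rho y)%E).
  pose f (p : V * W) := if p.1 \in ~` X then (rho p)%:E else 0%E.
  pose g (p : V * W) := if p.2 \in ~` Y then (rho p)%:E else 0%E.
  have f0 p : (0 <= f p)%E by rewrite /f; case: ifP.
  have g0 p : (0 <= g p)%E by rewrite /g; case: ifP.
  have -> : \esum_(x in ~` X) row_mass rho x = \esum_(p in [set: V * W]) f p.
    rewrite esum_mkcond esum_pair//; apply: eq_esum => x _; rewrite /f/=.
    by case: ifP => // _; rewrite esum1.
  have -> : \esum_(y in ~` Y) col_mass rho y = \esum_(p in [set: V * W]) g p.
    rewrite esum_mkcond esum_pair// esum_exchange//.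
    apply: eq_esum => y _; rewrite /g/=.
    by case: ifP => // _; rewrite esum1.
  rewrite -esumD// esum_mkcond; apply: le_esum => -[x y] _.
  case: ifPn => [|_]; last exact: adde_ge0.
  rewrite in_setE /= => nXY; rewrite /f /g/=.
  have [xX|xX] := boolP (x \in ~` X); first by rewrite leeDl// -/(g (x, y)).
  rewrite ifT ?add0e// in_setE => yY; apply: nXY; split => //=.
  by apply: contrapT => nx; move: xX; rewrite notin_setE.
by apply: leeD; apply: le_esum.
Qed.

Lemma subcoupling_limit (I : Type) (F : set_system I) (f : I -> V * W -> R) rho :
  ProperFilter F -> (forall i, subcoupling (f i)) ->
  (forall p, f ^~ p @ F --> rho p) -> subcoupling rho.
Proof.
move=> FF fsub frho.
(* A bound on a nonnegative series amounts to a bound on its finite partial sums, and these converge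
   along [F]. Taking [h] to run over a row or a column gives the two marginal bounds. *)
have bound (T : choiceType) (h : T -> V * W) (c : R) :
    (forall i, \esum_(t in [set: T]) (f i (h t))%:E <= c%:E)%E ->
    (\esum_(t in [set: T]) (rho (h t))%:E <= c%:E)%E.
  move=> hc; apply: ge_ereal_sup => _ [X [fX _] <-].
  rewrite fsumEFin// lee_fin.
  apply: (cvgr_to_le (cvg_fsum F X (fun t => (f ^~ (h t))) (rho \o h) _ fX _)).
    by move=> t; exact: frho.
  apply: nearW => i; rewrite -lee_fin -fsumEFin//; apply: le_trans (hc i).
  by apply: esum_ge; exists X.
split=> [p|p nr|x|y].
- apply: (cvgr_to_ge (frho p)); apply: nearW => i.
  by have [] := fsub i.
- apply/eqP; rewrite eq_le; apply/andP; split.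
    apply: (cvgr_to_le (frho p)); apply: nearW => i.
    by have [_ /(_ _ nr) /= -> _ _] := fsub i; exact: lexx.
  apply: (cvgr_to_ge (frho p)); apply: nearW => i.
  by have [_ /(_ _ nr) /= -> _ _] := fsub i; exact: lexx.
- by apply: (bound W (fun y => (x, y))) => i; have [_ _ + _] := fsub i; apply.
- by apply: (bound V (fun x => (x, y))) => i; have [_ _ _] := fsub i; apply.
Qed.

(* Uniform tightness ([subcoupling_tail]) keeps mass from escaping to infinity
   along an ultrafilter limit of a maximizing sequence. *)
Lemma maximal_exists : exists rho, maximal rho.
Proof.
pose S := [set total_mass rho | rho in subcoupling].
have sub0 : subcoupling (fun=> 0).
  by split=> // [x|y]; rewrite /row_mass /col_mass esum1// lee_fin.
have Sfin : ereal_sup S \is a fin_num.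
  rewrite ge0_fin_numE; last first.
    apply: ereal_sup_ubound; exists (fun=> 0) => //.
    by rewrite /total_mass esum1.
  apply: (@le_lt_trans _ _ (\esum_(x in [set: V]) (mu x)%:E)%E).
    by apply: ge_ereal_sup => _ [rho /subcoupling_total ? <-].
  by rewrite ltey_eq mu_fin.
have /choice[f fP] (n : nat) : exists rho, subcoupling rho /\
    (ereal_sup S - (n.+1%:R^-1)%:E < total_mass rho)%E.
  have n0 : (0 : R) < n.+1%:R^-1 by rewrite invr_gt0.
  by have [_ [rho ? <-] ?] := ub_ereal_sup_adherent n0 Sfin; exists rho.
have fsub n : subcoupling (f n) by case: (fP n).
(* One ultrafilter serves all coordinates at once, in place of a diagonal extraction: each
   coordinate stays in a compact segment, and a cluster point of an ultrafilter is a limit. *)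
have [G [GU sG]] := ultraFilterLemma (@eventually_filter).
have /choice[rho frho] (p : V * W) : exists l : R, f ^~ p @ G --> l.
  have inI : (f ^~ p @ G) `[(0 : R), mu p.1].
    apply: (@filterS _ G _ setT); last exact: filterT.
    move=> n _ /=; rewrite in_itv/= subcoupling_le// andbT.
    by have [+ _ _ _] := fsub n; apply.
  have [l [_ lG]] := segment_compact _ inI.
  exists l => U Ul; have [//|GnU] := in_ultra_setVsetC (f ^~ p @^-1` U) GU.
  by have [z [/= nUz Uz]] := lG (~` U) U GnU Ul.
have rsub : subcoupling rho by exact: (subcoupling_limit _ _ _ _ _ fsub frho).
exists rho; split => // rho' rho'sub.
apply: (@le_trans _ _ (ereal_sup S)).
  by apply: ereal_sup_ubound; exists rho'.
apply/lee_addgt0Pr => e e0.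
(* One quarter of [e] pays for the defect of the maximizing sequence and one for each of the two
   tails. *)
have arith (s t u d : R) : 0 < d -> u < d / 4 -> s - u < t + d / 4 + d / 4 -> s - d <= t.
  lra.
have e4 : 0 < e / 4 by rewrite divr_gt0.
have [|X fX Xe] := esum_tail _ _ _ mu_fin e4.
  by move=> x; rewrite lee_fin.
have [|Y fY Ye] := esum_tail _ _ _ nu_fin e4.
  by move=> y; rewrite lee_fin.
have fXY := finite_setX fX fY.
(* Only the finite block [X * Y] remains, and on it the pointwise limit can be summed. *)
apply: (@le_trans _ _ ((\sum_(p \in X `*` Y) rho p)%:E + e%:E)%E); last first.
  rewrite leeD2r// -fsumEFin//; apply: esum_ge.
  by exists (X `*` Y).
rewrite -(fineK Sfin) -EFinD lee_fin -lerBlDr.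
apply: (cvgr_to_ge (cvg_fsum G _ (fun p => (f ^~ p)) rho _ fXY frho)).
apply: sG; have := near_infty_natSinv_lt (PosNum e4).
apply: filterS => n /= ne.
have := lt_le_trans (fP n).2 (subcoupling_tail _ _ _ (fsub n) fX fY).
move=> /lt_le_trans => /(_ _ (leeD (leeD (le_refl _) Xe) Ye)).
rewrite -(fineK Sfin) -EFinB -!EFinD lte_fin /=.
exact: arith e0 ne.
Qed.

(** * Adding, removing and moving mass at single pairs *)

Definition bump (c : R) (q : V * W) rho : V * W -> R :=
  fun p => rho p + c * (p == q)%:R.

Lemma row_bump c q rho x : 0 <= c -> (forall p, 0 <= rho p) ->
  row_mass (bump c q rho) x = (row_mass rho x + (c * (x == q.1)%:R)%:E)%E.
Proof.
move=> c0 rho0; case: q => a b /=; rewrite /row_mass /bump.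
under eq_esum do rewrite EFinD.
rewrite esumD; [|by move=> y _; rewrite lee_fin..|]; last first.
  by move=> y _; rewrite lee_fin mulr_ge0.
congr (_ + _)%E; rewrite (esum_pred1 _ b)//= ?xpair_eqE ?eqxx ?andbT//.
  by rewrite lee_fin mulr_ge0.
by move=> y _ /eqP/negPf nb; rewrite xpair_eqE nb andbF mulr0.
Qed.

Lemma col_bump c q rho y : 0 <= c -> (forall p, 0 <= rho p) ->
  col_mass (bump c q rho) y = (col_mass rho y + (c * (y == q.2)%:R)%:E)%E.
Proof.
move=> c0 rho0; case: q => a b /=; rewrite /col_mass /bump.
under eq_esum do rewrite EFinD.
rewrite esumD; [|by move=> x _; rewrite lee_fin..|]; last first.
  by move=> x _; rewrite lee_fin mulr_ge0.
congr (_ + _)%E; rewrite (esum_pred1 _ a)//= ?xpair_eqE ?eqxx//.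
  by rewrite lee_fin mulr_ge0.
by move=> x _ /eqP/negPf na; rewrite xpair_eqE na mulr0.
Qed.

Lemma total_bump c q rho : 0 <= c -> (forall p, 0 <= rho p) ->
  total_mass (bump c q rho) = (total_mass rho + c%:E)%E.
Proof.
move=> c0 rho0; rewrite /total_mass /bump.
under eq_esum do rewrite EFinD.
rewrite esumD; [|by move=> y _; rewrite lee_fin..|]; last first.
  by move=> y _; rewrite lee_fin mulr_ge0.
congr (_ + _)%E; rewrite (esum_pred1 _ q)//= ?eqxx ?mulr1//.
by move=> y _ /eqP/negPf nb; rewrite nb mulr0.
Qed.

Lemma bump_ge0 c q rho : 0 <= c -> (forall p, 0 <= rho p) ->
  forall p, 0 <= bump c q rho p.
Proof. by move=> c0 rho0 p; rewrite addr_ge0// mulr_ge0. Qed.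

(** Removing mass is a bump by [- c], while the mass formulas above assume [0 <= c]. Viewing [rho]
    as a bump of the reduced measure makes them applicable. *)
Lemma bumpK c q rho : bump c q (bump (- c) q rho) = rho.
Proof. by apply/funext => p; rewrite /bump mulNr addrNK. Qed.

Lemma unbump_ge0 c q rho : c <= rho q -> (forall p, 0 <= rho p) ->
  forall p, 0 <= bump (- c) q rho p.
Proof.
move=> cq rho0 p; rewrite /bump; have [->|_] := eqVneq p q.
  by rewrite mulr1 subr_ge0.
by rewrite mulr0 addr0.
Qed.

Lemma row_real rho x : subcoupling rho ->
  row_mass rho x = (fine (row_mass rho x))%:E /\ fine (row_mass rho x) <= mu x.
Proof.
move=> [rho0 _ /(_ x) rowle _].
have rowfin : row_mass rho x \is a fin_num.
  by rewrite ge0_fin_numE ?row_ge0//; apply: le_lt_trans rowle _; exact: ltry.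
by rewrite fineK//; split => //; rewrite -lee_fin fineK.
Qed.

Lemma col_real rho y : subcoupling rho ->
  col_mass rho y = (fine (col_mass rho y))%:E /\ fine (col_mass rho y) <= nu y.
Proof.
move=> [rho0 _ _ /(_ y) colle].
have colfin : col_mass rho y \is a fin_num.
  by rewrite ge0_fin_numE ?col_ge0//; apply: le_lt_trans colle _; exact: ltry.
by rewrite fineK//; split => //; rewrite -lee_fin fineK.
Qed.

Lemma total_real rho : subcoupling rho -> total_mass rho = (fine (total_mass rho))%:E.
Proof.
move=> rsub; have [rho0 _ _ _] := rsub; rewrite fineK// ge0_fin_numE.
  by apply: le_lt_trans (subcoupling_total _ rsub) _; rewrite ltey_eq mu_fin.
by apply: esum_ge0 => p _; rewrite lee_fin.
Qed.

(** If row [a] and column [b] both had room, the smaller of the two deficits could be added at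
    [(a, b)], increasing the total mass. *)
Lemma maximal_saturated rho a b : maximal rho -> r a b ->
  (row_mass rho a < (mu a)%:E)%E -> ((nu b)%:E <= col_mass rho b)%E.
Proof.
move=> [rsub rmax] rab rowlt; have [rho0 rho_r rowle colle] := rsub.
rewrite leNgt; apply/negP => collt.
have [Ea _] := row_real _ a rsub; have [Eb _] := col_real _ b rsub.
pose e := Num.min (mu a - fine (row_mass rho a)) (nu b - fine (col_mass rho b)).
have e0 : 0 < e.
  rewrite lt_min !subr_gt0; move: rowlt collt.
  by rewrite {1}Ea {1}Eb !lte_fin => -> ->.
have : (total_mass (bump e (a, b) rho) <= total_mass rho)%E.
  apply: rmax; split => [||x|y].
  - by apply: bump_ge0 => //; exact: ltW.
  - move=> [x y] /= nr; rewrite /bump rho_r// add0r.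
    by have [[xa yb]|_] := eqVneq (x, y) (a, b); [case: nr; rewrite xa yb|rewrite mulr0].
  - rewrite (row_bump _ _ _ _ (ltW e0))//=.
    have [->|_] := eqVneq x a; last by rewrite mulr0 adde0 rowle.
    by rewrite mulr1 Ea -EFinD lee_fin -lerBrDl ge_min lexx.
  - rewrite (col_bump _ _ _ _ (ltW e0))//=.
    have [->|_] := eqVneq y b; last by rewrite mulr0 adde0 colle.
    by rewrite mulr1 Eb -EFinD lee_fin -lerBrDl ge_min lexx orbT.
by rewrite (total_bump _ _ _ (ltW e0))// (total_real _ rsub) -EFinD lee_fin; lra.
Qed.

(** Moving mass [e] from [(a', b)] to [(a, b)] preserves column [b] and the total mass, hence
    maximality, and opens a deficit in row [a']. *)
Lemma maximal_exchange rho a a' b : maximal rho -> r a b ->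
  (row_mass rho a < (mu a)%:E)%E -> 0 < rho (a', b) ->
  exists rho', maximal rho' /\ (row_mass rho' a' < (mu a')%:E)%E.
Proof.
move=> mrho rab rowlt pos; have [->|aa'] := eqVneq a' a; first by exists rho.
have [rsub rmax] := mrho; have [rho0 rho_r rowle colle] := rsub.
have [Ea _] := row_real _ a rsub; have [Ea' lea'] := row_real _ a' rsub.
(* The amount moved must fit into row [a] and be available at [(a', b)]. *)
pose e := Num.min (mu a - fine (row_mass rho a)) (rho (a', b)).
have e0 : 0 < e.
  by rewrite lt_min subr_gt0 pos andbT -lte_fin -Ea.
pose rho1 := bump (- e) (a', b) rho.
have rho10 p : 0 <= rho1 p by apply: unbump_ge0 => //; rewrite ge_min lexx orbT.
have Erow x : row_mass rho x = (row_mass rho1 x + (e * (x == a')%:R)%:E)%E.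
  by rewrite -[in LHS](bumpK e (a', b) rho) row_bump// ltW.
have Ecol y : col_mass rho y = (col_mass rho1 y + (e * (y == b)%:R)%:E)%E.
  by rewrite -[in LHS](bumpK e (a', b) rho) col_bump// ltW.
have Etot : total_mass rho = (total_mass rho1 + e%:E)%E.
  by rewrite -[in LHS](bumpK e (a', b) rho) total_bump// ltW.
have row1 x : x <> a' -> row_mass rho1 x = row_mass rho x.
  by move=> /eqP/negPf xa'; rewrite Erow xa' mulr0 adde0.
exists (bump e (a, b) rho1); split.
  split; last by move=> rho' /rmax; rewrite (total_bump _ _ _ (ltW e0))// -Etot.
  split => [||x|y].
  - by apply: bump_ge0 => //; exact: ltW.
  - move=> [x y] /= nr; rewrite /bump /rho1 /bump rho_r// add0r.
    have [[xa yb]|_] := eqVneq (x, y) (a, b); first by case: nr; rewrite xa yb.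
    have [[xa yb]|_] := eqVneq (x, y) (a', b); last by rewrite !mulr0 addr0.
    by move: pos; rewrite -xa -yb rho_r ?ltxx.
  - rewrite (row_bump _ _ _ _ (ltW e0))//=; have [->|_] := eqVneq x a.
      rewrite mulr1 row1; last by move=> /esym/eqP; rewrite (negPf aa').
      by rewrite Ea -EFinD lee_fin -lerBrDl ge_min lexx.
    rewrite mulr0 adde0; apply: le_trans (rowle x); rewrite Erow leeDl// lee_fin.
    by rewrite mulr_ge0// ltW.
  - by rewrite (col_bump _ _ _ _ (ltW e0))//= -Ecol colle.
rewrite (row_bump _ _ _ _ (ltW e0))//= (negPf aa') mulr0 adde0.
move: Ea'; rewrite {1}Erow eqxx mulr1 => /esym/eqP.
by rewrite -sube_eq ?fin_num_adde_defl// => /eqP <-; rewrite -EFinB lte_fin; lra.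
Qed.

(** * Averages of maximal subcouplings *)

Definition average rho1 rho2 : V * W -> R := fun p => (rho1 p + rho2 p) / 2.

Lemma esum_average (T : choiceType) (h : T -> V * W) rho1 rho2 :
  (forall p, 0 <= rho1 p) -> (forall p, 0 <= rho2 p) ->
  (\esum_(t in [set: T]) (average rho1 rho2 (h t))%:E =
   2^-1%:E * (\esum_(t in [set: T]) (rho1 (h t))%:E +
              \esum_(t in [set: T]) (rho2 (h t))%:E))%E.
Proof.
move=> rho10 rho20; rewrite -esumD; [|by move=> t _; rewrite lee_fin..].
rewrite -esumZl; [|by rewrite invr_ge0|by move=> t; rewrite -EFinD lee_fin addr_ge0].
by apply: eq_esum => t _; rewrite -EFinD -EFinM mulrC.
Qed.

(** The constraints are convex and the total mass is affine; two maximal subcouplings have the same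
    mass, so their average has it too. *)
Lemma maximal_average rho1 rho2 :
  maximal rho1 -> maximal rho2 -> maximal (average rho1 rho2).
Proof.
move=> [s1 m1] [s2 m2]; have [p1 r1 row1 col1] := s1; have [p2 r2 row2 col2] := s2.
split => [|rho' /[dup] s' /m1]; last first.
  have -> : total_mass (average rho1 rho2) = total_mass rho1; last by [].
  rewrite /total_mass (esum_average _ id)// -!/(total_mass _).
  have -> : total_mass rho2 = total_mass rho1 by apply/eqP; rewrite eq_le m1// m2.
  by rewrite (total_real _ s1) -EFinD -EFinM; congr EFin; lra.
split => [p|p nr|x|y].
- by rewrite divr_ge0// addr_ge0.
- by rewrite /average r1// r2// addr0 mul0r.
- have [E1 ?] := row_real _ x s1; have [E2 ?] := row_real _ x s2.
  rewrite /row_mass (esum_average _ (fun y => (x, y)))// -!/(row_mass _ x) E1 E2.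
  by rewrite -EFinD -EFinM lee_fin; lra.
- have [E1 ?] := col_real _ y s1; have [E2 ?] := col_real _ y s2.
  rewrite /col_mass (esum_average _ (fun x => (x, y)))// -!/(col_mass _ y) E1 E2.
  by rewrite -EFinD -EFinM lee_fin; lra.
Qed.

(** A deficit of [rho1] in row [a] is halved but not lost, since [rho2] cannot exceed [mu a]
    there. *)
Lemma average_row_lt rho1 rho2 a : maximal rho1 -> maximal rho2 ->
  (row_mass rho1 a < (mu a)%:E)%E -> (row_mass (average rho1 rho2) a < (mu a)%:E)%E.
Proof.
move=> [s1 _] [s2 _]; have [p1 _ _ _] := s1; have [p2 _ _ _] := s2.
have [E1 _] := row_real _ a s1; have [E2 ?] := row_real _ a s2.
rewrite {2}/row_mass (esum_average _ (fun y => (a, y)))// -!/(row_mass _ a) E1 E2.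
by rewrite -EFinD -EFinM !lte_fin; lra.
Qed.

(* [A] collects the rows left unsaturated by at least one maximal subcoupling.
   Since maximal subcouplings can be averaged, every maximal subcoupling
   saturates all columns [B] related to [A], and fills them from [A] only; this
   replaces the usual augmenting paths. *)
Theorem strassen :
  (forall A : set V, (\esum_(x in A) (mu x)%:E <=
     \esum_(y in [set y | exists2 x, A x & r x y]) (nu y)%:E)%E) ->
  exists2 rho, subcoupling rho & forall x, row_mass rho x = (mu x)%:E.
Proof.
move=> hall; have [rho mrho] := maximal_exists.
have [rsub rmax] := mrho; have [rho0 rho_r rowle colle] := rsub.
exists rho => // x0; apply/eqP; rewrite eq_le rowle/= leNgt; apply/negP => ltx0.
pose A := [set a | exists rho', maximal rho' /\ (row_mass rho' a < (mu a)%:E)%E].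
pose B := [set y | exists2 x, A x & r x y].
(* The average of [rho'] and [rho] leaves row [a] unsaturated, so it saturates column [b]. As
   neither column mass exceeds [nu b], both equal it. *)
have satB b : B b -> ((nu b)%:E <= col_mass rho b)%E.
  move=> [a [rho' [m' lta]] rab].
  have mavg := maximal_average _ _ m' mrho.
  have := maximal_saturated _ _ _ mavg rab (average_row_lt _ _ _ m' mrho lta).
  have [s' _] := m'; have [p' _ _ _] := s'.
  have [E1 ?] := col_real _ b s'; have [E2 ?] := col_real _ b rsub.
  rewrite {1}/col_mass (esum_average _ (fun x => (x, b)))// -!/(col_mass _ b) E1 E2.
  by rewrite -EFinD -EFinM !lee_fin; lra.
(* Were [rho (x, b)] positive, the average would be too, and an exchange with row [a] would leave
   row [x] unsaturated, putting [x] in [A]. *)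
have fromA b x : B b -> ~ A x -> rho (x, b) = 0.
  move=> [a [rho' [m' lta]] rab] nAx; apply/eqP; rewrite eq_le rho0 andbT leNgt.
  apply/negP => pos; apply: nAx.
  have mavg := maximal_average _ _ m' mrho.
  have lt_avg := average_row_lt _ _ _ m' mrho lta.
  apply: (maximal_exchange _ a x b mavg rab lt_avg).
  by have [[p' _ _ _] _] := m'; rewrite divr_gt0// ltr_wpDl.
(* The inequality is strict at [x0], which belongs to [A] by way of [rho] itself. *)
have : (\esum_(x in A) row_mass rho x < \esum_(x in A) (mu x)%:E)%E.
  apply: (lt_esum _ _ _ x0) => //.
  - by move=> x _; exact: row_ge0.
  - by exists rho.
  - rewrite ge0_fin_numE; last by apply: esum_ge0 => x _; rewrite lee_fin.
    apply: (@le_lt_trans _ _ (\esum_(x in [set: V]) (mu x)%:E)%E).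
      exact: le_esum_subset.
    by rewrite ltey_eq mu_fin.
rewrite ltNge => /negP; apply.
(* The contradiction: the [mu]-mass of [A] is at most the [nu]-mass of [B], which [rho] saturates
   using rows in [A] only, so it is at most the row masses over [A]. *)
apply: (le_trans (hall A)); rewrite -/B.
apply: (@le_trans _ _ (\esum_(y in B) col_mass rho y)%E); first exact: le_esum.
apply: (@le_trans _ _ (\esum_(y in B) \esum_(x in A) (rho (x, y))%:E)%E).
  apply: le_esum => y By; rewrite /col_mass (esumID A) => [|x _]; last by rewrite lee_fin.
  rewrite [X in (_ + X)%E]esum1 ?adde0 ?setTI//.
  by move=> x nAx; rewrite (fromA _ _ By nAx).
rewrite esum_exchange => [|y x]; last by rewrite lee_fin.
by apply: le_esum => x _; exact: le_esum_subset.
Qed.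

End Strassen.

(** * Couplings, stochastic domination and up-sets *)

Section CouplingDomination.
Context {R : realType} {V : countType}.
Variables (le : V -> V -> Prop) (mu1 mu2 : V -> R).
Hypotheses (le_refl : forall x, le x x)
  (le_tr : forall x y z, le x y -> le y z -> le x z).
Hypotheses (mu1P : prob_measure mu1) (mu2P : prob_measure mu2).

Definition upset (U : set V) : Prop := forall x y, le x y -> U x -> U y.

Definition upset_dom : Prop := forall U, upset U ->
  (\esum_(x in U) (mu1 x)%:E <= \esum_(x in U) (mu2 x)%:E)%E.

(** With [r := le], the points related to [A] form the up-set generated by [A]. It contains [A], so
    domination on up-sets gives the Hall condition of [strassen]. *)
Lemma upset_dom_coupling : upset_dom ->
  exists rho, coupling mu1 mu2 rho /\ compatible le rho.
Proof.
have [mu1_ge0 mu1_1] := mu1P; have [mu2_ge0 mu2_1] := mu2P => dom.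
have [|||||rho [rho0 rho_le _ colle] rowE] := @strassen R V V le mu1 mu2.
- by rewrite mu1_1.
- by rewrite mu2_1.
- by [].
- by [].
- move=> A; apply: (@le_trans _ _
      (\esum_(y in [set y | exists2 x, A x & le x y]) (mu1 y)%:E)%E).
    by apply: le_esum_subset => x Ax; exists x.
  by apply: dom => x y xy [z Az zx]; exists z => //; exact: le_tr xy.
have tot : total_mass rho = 1%E by rewrite total_row//; under eq_esum do rewrite rowE.
exists rho; split; last first.
  rewrite /compatible -tot /total_mass (esumID [set p | le p.1 p.2] setT); last first.
    by move=> p _; rewrite lee_fin.
  by rewrite [X in (_ + X)%E]esum1 ?adde0 ?setTI// => p nle; rewrite rho_le.
split=> //; split=> //; split=> // y.
(* The column masses lie below [mu2] and both have total 1, so a deficit in one column is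
   impossible. *)
apply/eqP; rewrite eq_le colle/= leNgt; apply/negP => lty.
have := lt_esum [set: V] (col_mass rho) (fun y => (mu2 y)%:E) y.
rewrite -total_col// tot mu2_1 ltxx => /(_ _ _ _ _ _) H; suff : false by [].
by apply: H => // x _; exact: col_ge0.
Qed.

(** The pairs in [le] already carry the whole mass 1, so the complementary sum vanishes, and with it
    each of its terms. *)
Lemma coupling_supp (rho : V * V -> R) p : coupling mu1 mu2 rho ->
  compatible le rho -> ~ le p.1 p.2 -> rho p = 0.
Proof.
move=> [rho0 [rho1 _]] comp nle; apply/eqP; rewrite eq_le rho0 andbT -lee_fin.
have rho0' q : (0 <= (rho q)%:E)%E by rewrite lee_fin.
move: rho1; rewrite (esumID [set p | le p.1 p.2])// !setTI comp.
have [t tE] : exists t : \bar R, t = \esum_(p in ~` [set p | le p.1 p.2]) (rho p)%:E.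
  by eexists.
have t0 : (0 <= t)%E by rewrite tE; exact: esum_ge0.
rewrite -tE => t1.
have -> : 0%:E = t.
  by case: t t1 {tE t0} => //= s [] /esym/eqP; rewrite addrC -subr_eq subrr => /eqP <-.
rewrite tE; have <- : \esum_(q in [set p]) (rho q)%:E = (rho p)%:E.
  by rewrite esum_set1.
by apply: le_esum_subset => _ ->.
Qed.

Lemma esum_marginal1 (rho : V * V -> R) (g : V -> R) : coupling mu1 mu2 rho ->
  (forall x, 0 <= g x) ->
  \esum_(x in [set: V]) (g x * mu1 x)%:E =
  \esum_(p in [set: V * V]) (g p.1 * rho p)%:E.
Proof.
move=> [rho0 [_ [rowE _]]] g0.
rewrite esum_pair => [|p]; last by rewrite lee_fin mulr_ge0.
apply: eq_esum => x _; rewrite EFinM -rowE -esumZl//.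
by move=> y; rewrite lee_fin.
Qed.

Lemma esum_marginal2 (rho : V * V -> R) (g : V -> R) : coupling mu1 mu2 rho ->
  (forall x, 0 <= g x) ->
  \esum_(x in [set: V]) (g x * mu2 x)%:E =
  \esum_(p in [set: V * V]) (g p.2 * rho p)%:E.
Proof.
move=> [rho0 [_ [_ colE]]] g0.
rewrite esum_pair => [|p]; last by rewrite lee_fin mulr_ge0.
rewrite esum_exchange => [|x y]; last by rewrite lee_fin mulr_ge0.
apply: eq_esum => x _; rewrite EFinM -colE -esumZl//.
by move=> y; rewrite lee_fin.
Qed.

(** Both expectations become sums against [rho], of [f p.1] and of [f p.2]. On the support of [rho]
    the positive part grows and the negative part shrinks from [p.1] to [p.2]; the two parts are
    compared separately. *)
Lemma coupling_stoch_dom (rho : V * V -> R) : coupling mu1 mu2 rho ->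
  compatible le rho -> stoch_dom le mu1 mu2.
Proof.
move=> cpl comp f _ finc; have [rho0 _] := cpl.
have pos (g : V -> R) : forall x, 0 <= Num.max (g x) 0.
  by move=> x; rewrite le_max lexx orbT.
rewrite /expect !(esum_marginal1 rho _ cpl (pos _)).
rewrite !(esum_marginal2 rho _ cpl (pos _)).
apply: leeB; apply: le_esum => p _; rewrite lee_fin.
  have [lep|nle] := pselect (le p.1 p.2); last first.
    by rewrite (coupling_supp _ _ cpl comp nle) !mulr0.
  by rewrite ler_wpM2r// ge_max !le_max lexx finc// orbT.
have [lep|nle] := pselect (le p.1 p.2); last first.
  by rewrite (coupling_supp _ _ cpl comp nle) !mulr0.
by rewrite ler_wpM2r// ge_max !le_max lexx lerN2 finc// orbT.
Qed.

(** The indicator of an up-set is a bounded increasing test function whose expectation is the mass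
    of the set. *)
Lemma stoch_dom_upset_dom : stoch_dom le mu1 mu2 -> upset_dom.
Proof.
move=> dom U upU; pose f x : R := (x \in U)%:R.
have expectE (mu : V -> R) : expect mu f = \esum_(x in U) (mu x)%:E.
  rewrite /expect [X in (_ - X)%E]esum1 ?sube0 => [|x _]; last first.
    by rewrite max_r ?mul0r// oppr_le0.
  rewrite [RHS]esum_mkcond; apply: eq_esum => x _.
  by rewrite /f max_l//; case: ifP => _; rewrite ?mul1r ?mul0r.
rewrite -!expectE; apply: dom => [|x y xy].
  by exists 1 => x; rewrite normr_nat lern1 leq_b1.
rewrite ler_nat; case: (boolP (x \in U)) => // /set_mem/(upU _ _ xy) Uy.
by rewrite mem_set.
Qed.

End CouplingDomination.

(** * Flows carried by self-avoiding paths *)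

Section PathBalance.
Context {R : realType} {V : countType}.
Variable E : V -> V -> Prop.

Lemma edge_in_mem (p : seq V) x y : edge_in x y p -> (x \in p) && (y \in p).
Proof.
elim: p => // a [//|b p] IH /= /orP[/andP[/eqP-> /eqP->]|/IH/andP[xp yp]].
  by rewrite !inE !eqxx orbT.
by rewrite inE xp orbT /= inE yp orbT.
Qed.

(** Since [a] does not recur, the first edge is not repeated, and the disjunction in [edge_in]
    becomes a sum. *)
Lemma Qpath_cons (a b : V) (p : seq V) x y : uniq [:: a, b & p] ->
  Qpath R [:: a, b & p] x y = ((a == x) && (b == y))%:R + Qpath R (b :: p) x y.
Proof.
move=> /andP[nap _]; rewrite /Qpath.
have -> : edge_in x y [:: a, b & p] =
  ((a == x) && (b == y)) || edge_in x y (b :: p) by [].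
case: (eqVneq a x) => [ax|_]; last by rewrite andFb mulr0n add0r.
have /negPf-> : ~~ edge_in x y (b :: p).
  by apply: contra nap => /edge_in_mem; rewrite ax => /andP[].
by rewrite orbF addr0.
Qed.

(** Every vertex of a self-avoiding path except the last is left exactly once. The additive form
    avoids subtraction of extended reals. *)
Lemma path_outflow (a : V) (p : seq V) x : uniq (a :: p) -> is_dpath E (a :: p) ->
  (outflow E (Qpath R (a :: p)) x + ((last a p == x)%:R : R)%:E =
   ((x \in a :: p)%:R : R)%:E)%E.
Proof.
elim: p a => [|b p IH] a U D.
  by rewrite /outflow esum1// add0e inE eq_sym.
have [Eab D'] := D; have /andP[nap U'] := U.
rewrite /outflow; under eq_esum do rewrite Qpath_cons// EFinD.
rewrite esumD => [|y _|y _]; [|by rewrite lee_fin ler0n..].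
rewrite -addeA -/(outflow E (Qpath R (b :: p)) x) (IH b)// [in RHS]in_cons.
have [->|xa] := eqVneq x a.
  rewrite (negPf nap) adde0 (esum_pred1 _ b) ?eqxx//.
  by move=> y _ /eqP; rewrite eq_sym => /negPf->.
by rewrite esum1 ?add0e.
Qed.

Lemma path_inflow (a : V) (p : seq V) x : uniq (a :: p) -> is_dpath E (a :: p) ->
  (inflow E (Qpath R (a :: p)) x + ((a == x)%:R : R)%:E =
   ((x \in a :: p)%:R : R)%:E)%E.
Proof.
elim: p a => [|b p IH] a U D.
  by rewrite /inflow esum1// add0e inE eq_sym.
have [Eab D'] := D; have /andP[nap U'] := U.
rewrite /inflow; under eq_esum do rewrite Qpath_cons// EFinD.
rewrite esumD => [|y _|y _]; [|by rewrite lee_fin ler0n..].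
rewrite -/(inflow E (Qpath R (b :: p)) x).
have -> : \esum_(y in [set y | E y x]) (((a == y) && (b == x))%:R : R)%:E =
    ((b == x)%:R : R)%:E.
  have [<-|bx] := eqVneq b x; last by rewrite esum1// => y _; rewrite andbF.
  rewrite (esum_pred1 _ a) ?eqxx//.
  by move=> y _ /eqP; rewrite eq_sym => /negPf->.
rewrite [X in (X + _)%E]addeC (IH b)// [in RHS]in_cons.
have [->|xa] := eqVneq x a; first by rewrite (negPf nap) add0e.
by rewrite adde0.
Qed.

Section Decomposition.
Variables (g : nat -> seq V) (q : nat -> R) (Q : V -> V -> R) (x0 : V).
Hypotheses (gP : forall n, directed_path E (g n) /\ uniq (g n))
  (q0 : forall n, 0 <= q n)
  (QE : forall x y, E x y ->
    (Q x y)%:E = \esum_(n in [set: nat]) (q n * Qpath R (g n) x y)%:E).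

Let Qpath_ge0 n x y : (0 <= (q n * Qpath R (g n) x y)%:E)%E.
Proof. by rewrite lee_fin mulr_ge0// ler0n. Qed.

(** The weighted sum of [path_outflow] over all paths: outflow plus mass ending at [x] is the mass
    visiting [x]. The inflow version has the same right-hand side, and comparing the two yields the
    divergence. The paths are nonempty, so [x0] is a mere default for [last] and [head]. *)
Lemma decomposition_outflow x :
  (outflow E Q x + \esum_(n in [set: nat]) (q n * (last x0 (g n) == x)%:R)%:E =
   \esum_(n in [set: nat]) (q n * (x \in g n)%:R)%:E)%E.
Proof.
rewrite /outflow; under eq_esum => y Exy do rewrite QE//.
rewrite esum_exchange// -esumD => [|n _|n _]; last 2 first.
  exact: esum_ge0.
  by rewrite lee_fin mulr_ge0.
apply: eq_esum => n _; under eq_esum do rewrite EFinM.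
rewrite esumZl => [|//|y]; last by rewrite lee_fin ler0n.
have [[sz D] U] := gP n; case: (g n) sz D U => // a p _ D U.
by rewrite !EFinM -muleDr ?path_outflow//; exact: fin_num_adde_defl.
Qed.

Lemma decomposition_inflow x :
  (inflow E Q x + \esum_(n in [set: nat]) (q n * (head x0 (g n) == x)%:R)%:E =
   \esum_(n in [set: nat]) (q n * (x \in g n)%:R)%:E)%E.
Proof.
rewrite /inflow; under eq_esum => y Exy do rewrite QE//.
rewrite esum_exchange// -esumD => [|n _|n _]; last 2 first.
  exact: esum_ge0.
  by rewrite lee_fin mulr_ge0.
apply: eq_esum => n _; under eq_esum do rewrite EFinM.
rewrite esumZl => [|//|y]; last by rewrite lee_fin ler0n.
have [[sz D] U] := gP n; case: (g n) sz D U => // a p _ D U.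
by rewrite !EFinM -muleDr ?path_inflow//; exact: fin_num_adde_defl.
Qed.

End Decomposition.

End PathBalance.

(** * Paths in an acyclic graph and enumeration of a countable index type *)

Lemma is_dpath_path {V : countType} (E : V -> V -> Prop) a (p : seq V) :
  is_dpath E (a :: p) <-> path (fun x y => `[< E x y >]) a p.
Proof.
elim: p a => [//|b p IH] a; split => [[Eab /IH D]|/andP[/asboolP Eab /IH D]].
  by rewrite /= D andbT; apply/asboolP.
by split.
Qed.

Lemma dpath_uniq {V : countType} (E : V -> V -> Prop) a (p : seq V) :
  (forall x, ~ reach E x x) -> is_dpath E (a :: p) -> uniq (a :: p).
Proof.
move=> acyclic; elim: p a => [//|b p IH] a D.
rewrite [uniq _]/= -/(uniq (b :: p)) IH ?andbT; last by have [] := D.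
apply/negP => abp; apply: (acyclic a).
move: D => /is_dpath_path; move: abp => /splitPr[p1 p2].
rewrite -cat_rcons cat_path => /andP[D1 _].
(* The stretch of the path from [a] up to its next occurrence is a directed cycle. *)
exists (rcons p1 a); split; first by case: p1 {D1}.
by rewrite last_rcons; split => //; apply/is_dpath_path.
Qed.

(** Turns a family indexed by pairs of vertices into the sequence that a decomposition requires:
    numbers that code no element are sent to [None] and contribute 0. *)
Lemma esum_pickle_inv {R : realType} {T : countType} (F : option T -> \bar R) :
  (forall o, (0 <= F o)%E) -> F None = 0%E ->
  \esum_(n in [set: nat]) F (pickle_inv n) = \esum_(t in [set: T]) F (Some t).
Proof.
move=> F0 FN; rewrite (esumID (range (@pickle T)))// !setTI.
rewrite [X in (_ + X)%E]esum1 ?adde0 => [|n nr]; last first.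
  case nE: (pickle_inv n) => [t|//]; case: nr; exists t => //.
  by have := @pickle_invK T n; rewrite nE.
rewrite esum_image; first by apply: eq_esum => t _; rewrite pickleK_inv.
by move=> s t _ _ /(pcan_inj pickleK).
Qed.

(** * Passing between flows and couplings *)

Section FlowCoupling.
Context {R : realType} {V : countType}.
Variables (le E : V -> V -> Prop) (mu1 mu2 : V -> R) (x0 : V).
Hypotheses (le_refl : forall x, le x x)
  (acyclic : forall x, ~ reach E x x)
  (leE : forall x y, x <> y -> (le x y <-> reach E x y)).

Lemma dpath_le a (p : seq V) : is_dpath E (a :: p) -> le a (last a p).
Proof.
case: p => [//|b p] D; have [<-//|/eqP ne] := eqVneq a (last a (b :: p)).
by apply/leE => //; exists (b :: p).
Qed.

(** Some path is provided for every pair, with the right endpoint only when [le x y], so that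
    [choice] can select a path for all pairs at once. *)
Lemma le_dpath x y : exists p : seq V,
  is_dpath E (x :: p) /\ (le x y -> last x p = y).
Proof.
have [<-|/eqP xy] := eqVneq x y; first by exists [::].
have [/leE-/(_ xy)[p [_ [D L]]]|nle] := pselect (le x y); first by exists p.
by exists [::].
Qed.

Lemma flow_upset_dom (Q : V -> V -> R) :
  (forall x, 0 <= mu1 x) -> (forall x, 0 <= mu2 x) ->
  finitely_decomposable E Q -> div_eq E Q (fun x => mu1 x - mu2 x) ->
  upset_dom le mu1 mu2.
Proof.
move=> mu10 mu20 [g [q [gP [q0 [qfin QE]]]]] divQ U upU.
(* With [f n] the last or the first vertex of [g n], this is the mass ending or starting at [x]. *)
pose hit (f : nat -> V) x := \esum_(n in [set: nat]) (q n * (f n == x)%:R)%:E.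
have term0 f n x : (0 <= (q n * ((f n : V) == x)%:R)%:E)%E.
  by rewrite lee_fin mulr_ge0.
have hit0 f x : (0 <= hit f x)%E by exact: esum_ge0.
have hitU f : \esum_(x in U) hit f x =
    \esum_(n in [set: nat]) (q n * (f n \in U)%:R)%:E.
  rewrite esum_exchange//; apply: eq_esum => n _.
  have [fU|fU] := boolP (f n \in U); last first.
    rewrite mulr0 esum1// => x Ux; have [fx|_] := eqVneq (f n) x.
      by move: fU; rewrite fx mem_set.
    by rewrite mulr0.
  rewrite (esum_pred1 _ (f n) _ (set_mem fU)) ?eqxx ?lee_fin ?mulr_ge0//.
  by move=> x _ /eqP; rewrite eq_sym => /negPf->; rewrite mulr0.
have hit_fin f x : hit f x \is a fin_num.
  rewrite ge0_fin_numE//; apply: le_lt_trans qfin; apply: le_esum => n _.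
  by rewrite lee_fin ler_piMr// lern1 leq_b1.
have balance x : ((mu1 x)%:E + hit (fun n => last x0 (g n)) x =
    (mu2 x)%:E + hit (fun n => head x0 (g n)) x)%E.
  have := decomposition_outflow E g q Q x0 gP q0 QE x.
  rewrite -(decomposition_inflow E g q Q x0 gP q0 QE x) -!/(hit (fun=> _) x).
  have [out_fin [in_fin]] := divQ x.
  rewrite -/(hit (fun n => last x0 (g n)) x) -/(hit (fun n => head x0 (g n)) x).
  rewrite -(fineK out_fin) -(fineK in_fin).
  rewrite -(fineK (hit_fin (fun n => last x0 (g n)) x)).
  rewrite -(fineK (hit_fin (fun n => head x0 (g n)) x)) /=.
  by move=> divx [] outin; congr EFin; lra.
have mu10' x : (0 <= (mu1 x)%:E)%E by rewrite lee_fin.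
have mu20' x : (0 <= (mu2 x)%:E)%E by rewrite lee_fin.
have sum_balance : (\esum_(x in U) (mu1 x)%:E +
      \esum_(x in U) hit (fun n => last x0 (g n)) x =
    \esum_(x in U) (mu2 x)%:E +
      \esum_(x in U) hit (fun n => head x0 (g n)) x)%E.
  by rewrite -!esumD//; apply: eq_esum => x _.
have lastU_fin : \esum_(x in U) hit (fun n => last x0 (g n)) x \is a fin_num.
  rewrite hitU ge0_fin_numE; last by apply: esum_ge0 => n _; rewrite lee_fin mulr_ge0.
  apply: le_lt_trans qfin; apply: le_esum => n _.
  by rewrite lee_fin ler_piMr// lern1 leq_b1.
(* Adding the finite mass that ends in [U] to both sides reduces the claim to comparing the masses
   that start and end in [U]; this holds path by path, as a path cannot leave an up-set. *)
rewrite -(leeD2rE _ _ lastU_fin) sum_balance leeD2l// !hitU.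
apply: le_esum => n _; rewrite lee_fin ler_wpM2l// ler_nat.
have [[sz D] _] := gP n; case: (g n) sz D => // a p _ /dpath_le alep /=.
case: (boolP (a \in U)) => // /set_mem/(upU _ _ alep) lastU.
by rewrite mem_set.
Qed.

Lemma coupling_flow (rho : V * V -> R) :
  coupling mu1 mu2 rho -> compatible le rho ->
  exists Q : V -> V -> R, flow E Q /\ finitely_decomposable E Q /\
    div_eq E Q (fun x => mu1 x - mu2 x).
Proof.
move=> cpl comp; have [rho0 [rho1 [rowE colE]]] := cpl.
have /choice[tl tlP] (p : V * V) := le_dpath p.1 p.2.
(* Numbers coding no pair receive the one-vertex path at [x0] with weight 0. *)
pose pth (o : option (V * V)) := if o is Some p then p.1 :: tl p else [:: x0].
pose wt (o : option (V * V)) := if o is Some p then rho p else 0.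
pose g (n : nat) := pth (pickle_inv n); pose q (n : nat) := wt (pickle_inv n).
have wt0 o : 0 <= wt o by case: o => /=.
have q0 n : 0 <= q n by exact: wt0.
have sumE (F : option (V * V) -> R) : (forall o, 0 <= F o) ->
    \esum_(n in [set: nat]) (q n * F (pickle_inv n))%:E =
    \esum_(p in [set: V * V]) (rho p * F (Some p))%:E.
  move=> F0; rewrite (esum_pickle_inv (fun o => (wt o * F o)%:E))//.
    by move=> o; rewrite lee_fin mulr_ge0.
  by rewrite mul0r.
have q1 : \esum_(n in [set: nat]) (q n)%:E = 1%E.
  rewrite -rho1; have := sumE (fun=> 1) (fun=> ler01).
  by under eq_esum do rewrite mulr1; under [RHS]eq_esum do rewrite mulr1.
have sub1 (h : nat -> R) : (forall n, 0 <= h n <= 1) ->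
    \esum_(n in [set: nat]) (q n * h n)%:E \is a fin_num.
  move=> h01; rewrite ge0_fin_numE; last first.
    apply: esum_ge0 => n _; rewrite lee_fin mulr_ge0//.
    by have /andP[] := h01 n.
  apply: (@le_lt_trans _ _ 1%E); last exact: ltry.
  rewrite -q1; apply: le_esum => n _; rewrite lee_fin ler_piMr//.
  by have /andP[] := h01 n.
have bool01 (b : bool) : (0 : R) <= b%:R <= 1 by rewrite ler0n lern1 leq_b1.
have gP n : directed_path E (g n) /\ uniq (g n).
  rewrite /g; case: (pickle_inv n) => [p|] //=.
  have [D _] := tlP p; split; first by split.
  exact: dpath_uniq.
(* The total weight 1 bounds this series, so [fine] does not alter its value. *)
pose Q x y := fine (\esum_(n in [set: nat]) (q n * Qpath R (g n) x y)%:E).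
have QE x y : E x y ->
    (Q x y)%:E = \esum_(n in [set: nat]) (q n * Qpath R (g n) x y)%:E.
  by move=> _; rewrite fineK// sub1// => n; exact: bool01.
exists Q; split; [|split] => [x y Exy||x].
- by rewrite fine_ge0//; apply: esum_ge0 => n _; rewrite lee_fin mulr_ge0.
- by exists g, q; split => //; split => //; split => //; rewrite q1 ltry.
have head_mass : \esum_(n in [set: nat]) (q n * (head x0 (g n) == x)%:R)%:E =
    (mu1 x)%:E.
  rewrite (sumE (fun o => (head x0 (pth o) == x)%:R))//= -rowE.
  rewrite esum_pair => [|p]; last by rewrite lee_fin mulr_ge0.
  rewrite (esum_pred1 _ x)//= ?eqxx.
  - by apply: eq_esum => y _; rewrite mulr1.
  - by apply: esum_ge0 => y _; rewrite lee_fin mulr1.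
  - by move=> y _ /eqP/negPf->; rewrite esum1// => z _; rewrite mulr0.
have last_mass : \esum_(n in [set: nat]) (q n * (last x0 (g n) == x)%:R)%:E =
    (mu2 x)%:E.
  rewrite (sumE (fun o => (last x0 (pth o) == x)%:R))//= -colE.
  rewrite (_ : esum _ _ = \esum_(p in [set: V * V]) (rho p * (p.2 == x)%:R)%:E).
    rewrite esum_pair => [|p]; last by rewrite lee_fin mulr_ge0.
    rewrite esum_exchange => [|y z]; last by rewrite lee_fin mulr_ge0.
    rewrite (esum_pred1 _ x)//= ?eqxx.
    - by apply: eq_esum => y _; rewrite mulr1.
    - by apply: esum_ge0 => y _; rewrite lee_fin mulr1.
    - by move=> y _ /eqP/negPf->; rewrite esum1// => z _; rewrite mulr0.
  (* The chosen path may miss [p.2] when [le p.1 p.2] fails, but then [rho p] is 0. *)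
  apply: eq_esum => p _; have [lep|nle] := pselect (le p.1 p.2).
    by have [_ /(_ lep)->] := tlP p.
  by rewrite (coupling_supp le mu1 mu2 _ _ cpl comp nle) !mul0r.
have outE := decomposition_outflow E g q Q x0 gP q0 QE x.
have inE := decomposition_inflow E g q Q x0 gP q0 QE x.
(* Outflow and inflow are summands of the mass visiting [x], which is finite; hence both are finite
   and the two balance equations can be subtracted. *)
have vis_fin : \esum_(n in [set: nat]) (q n * (x \in g n)%:R)%:E \is a fin_num.
  by apply: sub1 => n; exact: bool01.
move: outE inE vis_fin; rewrite head_mass last_mass; set N := esum _ _ => outE inE.
rewrite -{1}outE fin_numD => /andP[out_fin _].
have : N \is a fin_num by rewrite -outE fin_numD out_fin.
rewrite -{1}inE fin_numD => /andP[in_fin _]; split=> //; split=> //.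
move: outE; rewrite -inE -(fineK out_fin) -(fineK in_fin) /= => -[]; lra.
Qed.

End FlowCoupling.

(** * The equivalence of domination, compatible coupling and flow *)

Theorem theorem2p3 (R : realType) (V : countType)
  (le : V -> V -> Prop) (E : V -> V -> Prop) (mu1 mu2 : V -> R) :
  infinite_set [set: V] ->
  partial_order le ->
  is_DAG E ->
  (forall x y, x <> y -> (le x y <-> reach E x y)) ->
  prob_measure mu1 -> prob_measure mu2 ->
  (stoch_dom le mu1 mu2 <->
     exists rho : V * V -> R, coupling mu1 mu2 rho /\ compatible le rho) /\
  ((exists rho : V * V -> R, coupling mu1 mu2 rho /\ compatible le rho) <->
     exists Q : V -> V -> R, flow E Q /\ finitely_decomposable E Q /\
       div_eq E Q (fun x => mu1 x - mu2 x)).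
Proof.
move=> Vinf [le_rf [_ le_tr]] [_ acyclic] leE mu1P mu2P.
have /infinite_setN0[x0 _] := Vinf.
split; split.
- move=> /stoch_dom_upset_dom; exact: upset_dom_coupling.
- by move=> [rho [cpl comp]]; exact: coupling_stoch_dom cpl comp.
- by move=> [rho [cpl comp]]; exact: (coupling_flow le E _ _ x0 acyclic leE rho).
(* The endpoints of the paths need not be distributed as [mu1] and [mu2], so the coupling is
   obtained from domination on up-sets rather than read off from the paths. *)
- move=> [Q [_ [fd divQ]]]; apply: upset_dom_coupling => //.
  by apply: (flow_upset_dom le E _ _ x0 le_rf leE Q) => //; [case: mu1P|case: mu2P].
Qed.
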